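(* As $r\to\infty$, $$s(r+1,r)\ge\frac1r+(1-o(1))\left(\frac{t(r+1,r)-1/r}{2r\cdot r!}\right)^2;$$ that is, there exists a sequence of real numbers $(\varepsilon_r)_{r\ge3}$ with $\varepsilon_r\to0$ as $r\to\infty$ such that for every integer $r\ge3$, $s(r+1,r)\ge\frac1r+(1-\varepsilon_r)\left(\frac{t(r+1,r)-1/r}{2r\cdot r!}\right)^2$.
   Context: Let $r<k$ be positive integers and $X$ a set. A sequence $x\in X^r$ covers a sequence $a\in X^k$ if $x$ is a (not necessarily contiguous) subsequence of $a$, i.e., $x$ is obtained from $a$ by removing $k-r$ entries while keeping the order of the remaining entries. A set $C\subseteq X^r$ covering $X^k$ (i.e., such that every sequence in $X^k$ is covered by at least one sequence in $C$) is called a covering $(k-r)$-insertion code over $X$. Write $[n]=\{0,1,\ldots,n-1\}$. $S(n,k,r)$ denotes the minimum cardinality of a covering $(k-r)$-insertion code $C\subseteq[n]^r$ over $[n]$, and $s(k,r)=\lim_{n\to\infty}S(n,k,r)/n^r$ (this limit exists). For $1<r<k<n$, a family $C$ of $r$-element subsets of $[n]$ is a Turán $(n,k,r)$-system if every $k$-element subset of $[n]$ contains at least one member of $C$. $T(n,k,r)$ denotes the minimum cardinality of a Turán $(n,k,r)$-system, and $t(k,r)=\lim_{n\to\infty}T(n,k,r)/\binom nr$ is the Turán density (the limit exists because the sequence is non-decreasing in $n$). *)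

(* Defs.v *)
From HB Require Import structures.
From mathcomp Require Import all_boot all_order all_algebra.
From mathcomp Require Import all_classical all_reals all_analysis.
Import Order.TTheory GRing.Theory Num.Theory.
Import numFieldNormedType.Exports.

Set Implicit Arguments.
Unset Strict Implicit.
Unset Printing Implicit Defensive.

Definition covers (X : eqType) (r k : nat) (x : r.-tuple X) (a : k.-tuple X) :
    bool :=
  subseq x a.

Definition covering_insertion_code (X : finType) (k r : nat)
    (C : {set r.-tuple X}) : bool :=
  [forall a : k.-tuple X, [exists x in C, covers x a]].

(* S(n, k, r). The minimum is attained when r <= k, because the seed [set: _]
   is then a covering code. *)
Definition min_insertion_code (n k r : nat) : nat :=
  #|[arg min_(C < [set: r.-tuple 'I_n] | covering_insertion_code k C) #|C| ]|.

Definition turan_system (n k r : nat) (C : {set {set 'I_n}}) : bool :=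
  [forall A in C, #|A| == r] &&
  [forall K : {set 'I_n}, (#|K| == k) ==> [exists A in C, A \subset K]].

(* T(n, k, r). The minimum is attained when r <= k, because the seed, the family
   of all r-subsets, is then a Turan system. *)
Definition min_turan (n k r : nat) : nat :=
  #|[arg min_(C < [set A : {set 'I_n} | #|A| == r] | turan_system k r C) #|C| ]|.

Local Open Scope classical_set_scope.
Local Open Scope ring_scope.

(* s(k, r) *)
Definition insertion_density (R : realType) (k r : nat) : R :=
  limn (fun n : nat => (min_insertion_code n k r)%:R / n%:R ^+ r : R).

(* t(k, r) *)
Definition turan_density (R : realType) (k r : nat) : R :=
  limn (fun n : nat => (min_turan n k r)%:R / 'C(n, r)%:R : R).

(* Main.v *)
Require Import Defs.
From HB Require Import structures.
From mathcomp Require Import all_boot all_order all_algebra.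
From mathcomp Require Import fingroup perm.
From mathcomp Require Import all_classical all_reals all_analysis.
From mathcomp Require Import ring lra zify.
Import Order.TTheory GRing.Theory Num.Theory.
Import numFieldNormedType.Exports.

(** The bound follows, with all epsilons equal to 0, from the chain
    1/r <= t(r+1,r) <= s(r+1,r) and t(r+1,r) <= 1: writing d = t(r+1,r) - 1/r,
    one has 0 <= d <= 1, so d is at least (d / (2 r r!))^2.

    The inequality t(k,r) <= s(k,r) comes from ordering the alphabet. Given a
    covering code C over [n] and a permutation of [n], the r-subsets of [n]
    whose arrangement in the permuted order belongs to C form a Turan system,
    because a k-subset listed in that order is a word covered by C, and the
    codeword covering it is listed in the same order
    ([turan_system_arrangement]). Averaging over all permutations, some such
    system has at most 1/r! times as many members as C has repetition-free
    codewords ([fact_mul_min_turan_le]).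

    The inequality t(r+1,r) >= 1/r is de Caen's argument. Let C be a Turan
    (n,r+1,r)-system. If an r-set A is not in C then, for every v outside A,
    some member of C is obtained from A by exchanging an element of A for v.
    Counting these exchanges through the (r-1)-sets D, in terms of the number
    of members of C containing D, and applying the Cauchy-Schwarz inequality
    gives |C| / binomial(n,r) >= (n-r) / (r (n-r+1)) ([min_turan_bin_ge]).

    Both densities are values of [lim], so convergence has to be proved.
    T(n,k,r) / binomial(n,r) is nondecreasing by averaging over the deletion of
    one point. S(n,k,r) / n^r is compared with the minimal number of
    repetition-free codewords divided by the falling factorial: this ratio is
    nondecreasing for the same reason, and the difference between the two tends
    to 0 because almost all words are repetition-free. *)

Set Implicit Arguments.
Unset Strict Implicit.
Unset Printing Implicit Defensive.

(** * Covering insertion codes and their repetition-free words *)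

Lemma subseq_mapP (T U : eqType) (f : T -> U) (x : seq U) (s : seq T) :
  subseq x (map f s) -> exists2 y, subseq y s & x = map f y.
Proof.
case/subseqP => m sz_m ->; exists (mask m s); first exact: mask_subseq.
by rewrite map_mask.
Qed.

Lemma covering_insertion_code_setT (X : finType) (k r : nat) :
  r <= k -> @covering_insertion_code X k r [set: r.-tuple X].
Proof.
move=> le_rk; apply/forallP => a; apply/existsP.
have sz : size (take r a) == r by rewrite size_takel ?size_tuple.
by exists (Tuple sz); rewrite inE /covers /= take_subseq.
Qed.

(** Covering codes pull back along any map of alphabets, injective or not. *)
Lemma covering_insertion_code_preim (X Y : finType) (k r : nat) (f : X -> Y)
    (C : {set r.-tuple Y}) :
  covering_insertion_code k C ->
  covering_insertion_code k [set x : r.-tuple X | map_tuple f x \in C].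
Proof.
move=> /forallP covC; apply/forallP => a.
have /existsP[x /andP[Cx /subseq_mapP[y y_a xE]]] := covC (map_tuple f a).
have sz_y : size y == r by rewrite -(size_tuple x) xE size_map.
apply/existsP; exists (Tuple sz_y); rewrite inE /covers /= y_a andbT.
by rewrite (_ : map_tuple f _ = x) //; apply: val_inj.
Qed.

Lemma covering_insertion_codeS (X : finType) (k r : nat)
    (C D : {set r.-tuple X}) :
  C \subset D -> covering_insertion_code k C -> covering_insertion_code k D.
Proof.
move=> /fintype.subsetP sCD /forallP covC; apply/forallP => a.
have /existsP[x /andP[Cx x_a]] := covC a.
by apply/existsP; exists x; rewrite sCD.
Qed.

(** The codewords without repeated letters. *)
Definition uniq_words (X : finType) (r : nat) (C : {set r.-tuple X}) :
    {set r.-tuple X} :=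
  [set x in C | uniq x].

(** The minimal number of repetition-free words in a covering insertion code
    over [n]. As for [min_insertion_code], the seed of the minimum is the full
    set of words, which is a covering code when r <= k. *)
Definition min_uniq_words (n k r : nat) : nat :=
  #|uniq_words [arg min_(C < [set: r.-tuple 'I_n] | covering_insertion_code k C)
      #|uniq_words C| ]|.

Lemma min_uniq_wordsP (n k r : nat) : r <= k ->
  exists2 C : {set r.-tuple 'I_n}, covering_insertion_code k C &
    #|uniq_words C| = min_uniq_words n k r.
Proof.
rewrite /min_uniq_words => le_rk.
case: arg_minnP => [|C covC _]; first exact: covering_insertion_code_setT.
by exists C.
Qed.

Lemma min_uniq_words_le (n k r : nat) (C : {set r.-tuple 'I_n}) : r <= k ->
  covering_insertion_code k C -> min_uniq_words n k r <= #|uniq_words C|.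
Proof.
rewrite /min_uniq_words => le_rk covC.
case: arg_minnP => [|D _]; first exact: covering_insertion_code_setT.
exact.
Qed.

Lemma min_insertion_codeP (n k r : nat) : r <= k ->
  exists2 C : {set r.-tuple 'I_n}, covering_insertion_code k C &
    #|C| = min_insertion_code n k r.
Proof.
rewrite /min_insertion_code => le_rk.
case: arg_minnP => [|C covC _]; first exact: covering_insertion_code_setT.
by exists C.
Qed.

Lemma min_insertion_code_le (n k r : nat) (C : {set r.-tuple 'I_n}) : r <= k ->
  covering_insertion_code k C -> min_insertion_code n k r <= #|C|.
Proof.
rewrite /min_insertion_code => le_rk covC.
case: arg_minnP => [|D _]; first exact: covering_insertion_code_setT.
exact.
Qed.

Lemma card_uniq_words_setT (n r : nat) :
  #|uniq_words [set: r.-tuple 'I_n]| = n ^_ r.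
Proof.
transitivity #|[set t : r.-tuple 'I_n | all predT t & uniq t]|.
  by apply: eq_card => t; rewrite !inE all_predT.
by rewrite card_uniq_tuples; congr (_ ^_ _); rewrite -[RHS]card_ord; apply: eq_card.
Qed.

Lemma min_uniq_words_le_ffact (n k r : nat) : r <= k ->
  min_uniq_words n k r <= n ^_ r.
Proof.
move=> le_rk; rewrite -card_uniq_words_setT.
exact/min_uniq_words_le/covering_insertion_code_setT.
Qed.

Lemma min_uniq_words_le_insertion (n k r : nat) : r <= k ->
  min_uniq_words n k r <= min_insertion_code n k r.
Proof.
move=> le_rk; have [C covC <-] := min_insertion_codeP n le_rk.
apply: (leq_trans (min_uniq_words_le le_rk covC)).
by apply/subset_leq_card/fintype.subsetP => x; rewrite inE => /andP[].
Qed.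

(** Adding all the words with a repeated letter to a code does not change its
    repetition-free words; there are n ^ r - n ^_ r of them. *)
Lemma min_insertion_code_le_uniq (n k r : nat) : r <= k ->
  min_insertion_code n k r + n ^_ r <= min_uniq_words n k r + n ^ r.
Proof.
move=> le_rk; have [C covC <-] := min_uniq_wordsP n le_rk.
pose N := [set x : r.-tuple 'I_n | ~~ uniq x].
have cardN : #|N| + n ^_ r = n ^ r.
  rewrite -card_uniq_words_setT -[in RHS](card_ord n) -card_tuple -(cardsC N).
  by congr (_ + _); apply: eq_card => x; rewrite !inE negbK.
have cover_CN : covering_insertion_code k (uniq_words C :|: N).
  apply: covering_insertion_codeS covC; apply/fintype.subsetP => x.
  by rewrite !inE => ->; rewrite orbN.
rewrite -cardN addnA leq_add2r.
exact: leq_trans (min_insertion_code_le le_rk cover_CN) (leq_card_setU _ _).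
Qed.

(** Averaging over the deletion of a letter i from an alphabet of n + 1 letters:
    a repetition-free word avoids exactly n + 1 - r letters, so it survives in
    that many of the n + 1 restricted codes. *)
Lemma mul_min_uniq_words_le (n k r : nat) : r <= k ->
  n.+1 * min_uniq_words n k r <= (n.+1 - r) * min_uniq_words n.+1 k r.
Proof.
move=> le_rk; have [C covC <-] := min_uniq_wordsP n.+1 le_rk.
pose D (i : 'I_n.+1) := [set x : r.-tuple 'I_n | map_tuple (lift i : 'I_n -> 'I_n.+1) x \in C].
have cardD i : #|uniq_words (D i)| <= #|[set x : r.-tuple 'I_n.+1 in uniq_words C | i \notin x]|.
  rewrite -(@card_imset _ _ (map_tuple (lift i) : r.-tuple 'I_n -> r.-tuple 'I_n.+1)); last first.
    by move=> x y /(congr1 val) /= /(inj_map lift_inj) /val_inj.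
  apply/subset_leq_card/fintype.subsetP => _ /imsetP[x + ->].
  rewrite !inE /= (map_inj_uniq lift_inj) => /andP[-> ->] /=.
  by apply/mapP => -[j _ ij]; move: (neq_lift i j); rewrite -ij eqxx.
have -> : n.+1 * min_uniq_words n k r = \sum_(i < n.+1) min_uniq_words n k r.
  by rewrite big_const_ord iter_addn_0 mulnC.
have le1 : \sum_(i < n.+1) min_uniq_words n k r <=
    \sum_(i < n.+1) \sum_(x in uniq_words C) (i \notin x).
  apply: leq_sum => i _; apply: (leq_trans _ (leq_trans (cardD i) _)).
    exact/min_uniq_words_le/covering_insertion_code_preim.
  rewrite -sum1_card big_mkcond [X in _ <= X]big_mkcond /=.
  by apply: leq_sum => x _; rewrite !inE; case: (_ \in C); case: (uniq _); case: (_ \in _).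
apply: (leq_trans le1); rewrite exchange_big /= mulnC -sum_nat_const.
apply: leq_sum => x; rewrite inE => /andP[_ ux].
rewrite -big_mkcond sum1_card.
have := cardC (mem x); rewrite card_ord (card_uniqP ux) size_tuple => cardx.
rewrite -[X in X - _]cardx addKn; apply: eq_leq.
by apply: eq_card => i; rewrite !inE.
Qed.

(** * Turan systems *)

Lemma turan_system_all (n k r : nat) : r <= k ->
  turan_system k r [set A : {set 'I_n} | #|A| == r].
Proof.
move=> le_rk; apply/andP; split.
  by apply/forallP => A; rewrite inE; apply/implyP.
apply/forallP => K; apply/implyP => /eqP cardK.
have sz : size (take r (enum K)) = r by rewrite size_takel // -cardE cardK.
have sub_K : {subset take r (enum K) <= K}.
  by move=> x /mem_take; rewrite mem_enum.
apply/existsP; exists [set x in take r (enum K)]; rewrite inE cardsE.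
rewrite (card_uniqP _) ?take_uniq ?enum_uniq // sz eqxx /=.
by apply/fintype.subsetP => x; rewrite inE => /sub_K.
Qed.

Lemma min_turanP (n k r : nat) : r <= k ->
  exists2 C : {set {set 'I_n}}, turan_system k r C & #|C| = min_turan n k r.
Proof.
rewrite /min_turan => le_rk.
case: arg_minnP => [|C turC _]; first exact: turan_system_all.
by exists C.
Qed.

Lemma min_turan_le (n k r : nat) (C : {set {set 'I_n}}) : r <= k ->
  turan_system k r C -> min_turan n k r <= #|C|.
Proof.
rewrite /min_turan => le_rk turC.
case: arg_minnP => [|D _]; first exact: turan_system_all.
exact.
Qed.

Lemma min_turan_le_bin (n k r : nat) : r <= k -> min_turan n k r <= 'C(n, r).
Proof.
move=> le_rk; apply: (leq_trans (min_turan_le le_rk (turan_system_all n le_rk))).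
by rewrite card_draws card_ord.
Qed.

Lemma turan_system_preim (m n k r : nat) (f : 'I_m -> 'I_n)
    (C : {set {set 'I_n}}) : injective f ->
  turan_system k r C ->
  turan_system k r [set A : {set 'I_m} | f @: A \in C].
Proof.
move=> f_inj /andP[/forallP sizeC /forallP turC]; apply/andP; split.
  apply/forallP => A; rewrite inE; apply/implyP => CfA.
  by rewrite -(card_imset _ f_inj); exact: (implyP (sizeC _)).
apply/forallP => K; apply/implyP => cardK.
have := turC (f @: K); rewrite card_imset // cardK /= => /existsP[B /andP[CB sBK]].
have fB : f @: (f @^-1: B) = B.
  apply/setP => y; apply/imsetP/idP => [[x + ->]|By]; first by rewrite inE.
  have /imsetP[x _ yE] := fintype.subsetP sBK _ By.
  by exists x; rewrite // inE -yE.
apply/existsP; exists (f @^-1: B); rewrite inE fB CB /=.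
apply/fintype.subsetP => x; rewrite inE => /(fintype.subsetP sBK).
by rewrite (mem_imset _ _ f_inj).
Qed.

(** Averaging over the deletion of a point i of [n + 1]: an r-set avoids n + 1 - r
    points. *)
Lemma mul_min_turan_le (n k r : nat) : r <= k ->
  n.+1 * min_turan n k r <= (n.+1 - r) * min_turan n.+1 k r.
Proof.
move=> le_rk; have [C turC <-] := min_turanP n.+1 le_rk.
pose D (i : 'I_n.+1) := [set A : {set 'I_n} | (lift i : 'I_n -> 'I_n.+1) @: A \in C].
have cardD i : #|D i| <= #|[set B in C | i \notin B]|.
  rewrite -(card_imset _ (imset_inj (@lift_inj _ i))).
  apply/subset_leq_card/fintype.subsetP => _ /imsetP[A + ->].
  rewrite !inE => -> /=.
  by apply/imsetP => -[j _ ij]; move: (neq_lift i j); rewrite -ij eqxx.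
have -> : n.+1 * min_turan n k r = \sum_(i < n.+1) min_turan n k r.
  by rewrite big_const_ord iter_addn_0 mulnC.
have le1 : \sum_(i < n.+1) min_turan n k r <=
    \sum_(i < n.+1) \sum_(B in C) (i \notin B).
  apply: leq_sum => i _; apply: (leq_trans _ (leq_trans (cardD i) _)).
    exact/min_turan_le/turan_system_preim/turC/lift_inj.
  rewrite -sum1_card big_mkcond [X in _ <= X]big_mkcond /=.
  by apply: leq_sum => B _; rewrite !inE; case: (_ \in C); case: (_ \in _).
apply: (leq_trans le1); rewrite exchange_big /= mulnC -sum_nat_const.
apply: leq_sum => B CB; have /andP[/forallP /(_ B)] := turC.
rewrite CB /= => /eqP cardB _.
rewrite -big_mkcond sum1_card.
have := cardsC B; rewrite card_ord cardB => cardCB.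
rewrite -[X in X - _]cardCB addKn; apply: eq_leq.
by apply: eq_card => i; rewrite !inE.
Qed.

(** * From covering codes to Turan systems *)

(** Two permutations sending the list of A to the same word differ by a
    permutation that fixes A pointwise. *)
Lemma card_perm_map_le (T : finType) (A : {set T}) (x : seq T) :
  #|[set s : {perm T} | map s (enum A) == x]| <= (#|T| - #|A|)`!.
Proof.
set F := [set s | _]; have [->|[s0]] := set_0Vmem F; first by rewrite cards0.
rewrite inE => /eqP s0x.
have -> : #|T| - #|A| = #|~: A| by rewrite -(cardsC A) addKn.
rewrite -card_perm -(card_imset _ (mulIg s0^-1%g)).
apply/subset_leq_card/fintype.subsetP => _ /imsetP[s + ->].
rewrite !inE => /eqP; rewrite -s0x => /eq_in_map ss0.
apply/fintype.subsetP => a; rewrite !inE; apply: contra => Aa.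
by rewrite permM (ss0 a) ?mem_enum // permK.
Qed.

(** The r-subsets of [n] whose elements, listed in the order given by [s],
    form a word of C. *)
Definition arrangement_family (n r : nat) (C : {set r.-tuple 'I_n})
    (s : 'S_n) : {set {set 'I_n}} :=
  [set A : {set 'I_n} | (#|A| == r) && [exists x in C, map s (enum A) == x]].

Lemma turan_system_arrangement (n k r : nat) (C : {set r.-tuple 'I_n}) (s : 'S_n) :
  covering_insertion_code k C -> turan_system k r (arrangement_family C s).
Proof.
move=> /forallP covC; apply/andP; split.
  by apply/forallP => A; rewrite inE; apply/implyP => /andP[].
apply/forallP => K; apply/implyP => /eqP cardK.
have sz : size (map s (enum K)) == k by rewrite size_map -cardE cardK.
have /existsP[x /andP[Cx /subseq_mapP[y y_K xE]]] := covC (Tuple sz).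
have y_T : subseq y (enum 'I_n).
  by apply: (subseq_trans y_K); rewrite {1}enumT; exact: filter_subseq.
have uy : uniq y := subseq_uniq y_T (enum_uniq _).
have enum_y : enum [set i in y] = y.
  rewrite [RHS](elimT (subseq_uniqP (enum_uniq _)) y_T) enumT.
  by apply: eq_filter => i; rewrite !inE.
apply/existsP; exists [set i in y]; rewrite inE enum_y.
apply/andP; split; last first.
  by apply/fintype.subsetP => i; rewrite inE => /(mem_subseq y_K); rewrite mem_enum.
apply/andP; split; last by apply/existsP; exists x; rewrite Cx xE eqxx.
by rewrite cardE enum_y -(size_map s) -xE size_tuple.
Qed.

Lemma fact_mul_min_turan_le (n k r : nat) : r <= k -> r <= n ->
  r`! * min_turan n k r <= min_uniq_words n k r.
Proof.
move=> le_rk le_rn; have [C covC <-] := min_uniq_wordsP n le_rk.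
have lower : n`! * min_turan n k r <= \sum_(s : 'S_n) #|arrangement_family C s|.
  rewrite -{1}card_Sn -sum_nat_const; apply: leq_sum => s _.
  exact/min_turan_le/turan_system_arrangement.
have upper : \sum_(s : 'S_n) #|arrangement_family C s| <=
    'C(n, r) * (#|uniq_words C| * (n - r)`!).
  have -> : \sum_(s : 'S_n) #|arrangement_family C s| =
      \sum_(A : {set 'I_n} | #|A| == r)
        \sum_(s : 'S_n) [exists x in C, map s (enum A) == x].
    rewrite exchange_big; apply: eq_bigr => s _ /=.
    rewrite -sum1_card big_mkcond [RHS]big_mkcond /=; apply: eq_bigr => A _.
    by rewrite inE; case: (_ == r) => //=; case: existsP.
  rewrite -[X in 'C(X, r)]card_ord -card_draws -sum_nat_const.
  rewrite [X in _ <= X](eq_bigl (fun A : {set 'I_n} => #|A| == r)); last first.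
    by move=> A; rewrite inE.
  apply: leq_sum => A /eqP cardA.
  apply: (@leq_trans
      (\sum_(x in uniq_words C) #|[set s : 'S_n | map s (enum A) == x]|)).
    rewrite [X in _ <= X](eq_bigr (fun x : r.-tuple 'I_n =>
        \sum_(s : 'S_n) (map s (enum A) == x :> seq _))); last first.
      move=> x _; rewrite -sum1_card big_mkcond; apply: eq_bigr => s _.
      by rewrite inE; case: (_ == _).
    rewrite exchange_big; apply: leq_sum => s _ /=.
    case: existsP => // -[x /andP[Cx /eqP sx]].
    rewrite (bigD1 x) /= ?sx ?eqxx //.
    by rewrite inE Cx -sx (map_inj_uniq perm_inj) enum_uniq.
  rewrite -sum_nat_const; apply: leq_sum => x _.
  by have := card_perm_map_le A x; rewrite card_ord cardA.
have := leq_trans lower upper.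
rewrite -(bin_fact le_rn) -!mulnA leq_pmul2l ?bin_gt0 //.
by rewrite [X in _ <= X]mulnC mulnCA leq_pmul2l ?fact_gt0.
Qed.

(** * The lower bound of de Caen *)

(** Double counting of the pairs formed by a (q+1)-set and one of its elements,
    equivalently by a q-set and an element outside it. *)
Lemma sum_incidence (T : finType) (q : nat) (F : {set T} -> T -> nat) :
  \sum_(D : {set T} | #|D| == q) \sum_(u | u \notin D) F (u |: D) u =
  \sum_(A : {set T} | #|A| == q.+1) \sum_(u in A) F A u.
Proof.
rewrite !pair_big_dep /=.
rewrite [RHS](reindex_onto (fun p => (p.2 |: p.1, p.2))
  (fun p => (p.1 :\ p.2, p.2))) /=; last first.
  by case=> A u /andP[_ uA] /=; rewrite finset.setD1K.
apply: eq_bigl => -[D u] /=; rewrite finset.setU11 andbT xpair_eqE eqxx andbT.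
case: (boolP (u \in D)) => [uD|uD]; last first.
  by rewrite cardsU1 uD finset.setU1K // eqxx !andbT.
rewrite andbF; apply/esym/negbTE; rewrite negb_and; apply/orP; right.
by apply: contraTneq uD => <-; rewrite !inE eqxx.
Qed.

(** The number of members of C of the form D + u with u outside D. *)
Definition codegree (T : finType) (C : {set {set T}}) (D : {set T}) : nat :=
  #|[set u | (u \notin D) && (u |: D \in C)]|.

Lemma codegreeE (T : finType) (C : {set {set T}}) (D : {set T}) :
  codegree C D = \sum_(u | u \notin D) (u |: D \in C).
Proof.
rewrite /codegree -sum1_card big_mkcond [RHS]big_mkcond; apply: eq_bigr => u _.
by rewrite inE; case: (_ \in D); case: (_ \in C).
Qed.

Lemma codegreeC (T : finType) (C : {set {set T}}) (D : {set T}) :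
  codegree C D + \sum_(u | u \notin D) (u |: D \notin C) = #|T| - #|D|.
Proof.
rewrite codegreeE -big_split /= -(cardsC D) addKn -sum1_card.
rewrite [RHS](eq_bigl (fun u => u \notin D)); last by move=> u; rewrite inE.
by apply: eq_bigr => u _; case: (_ \in C).
Qed.

Lemma sum_codegree (n k q : nat) (C : {set {set 'I_n}}) :
  turan_system k q.+1 C ->
  \sum_(D : {set 'I_n} | #|D| == q) codegree C D = q.+1 * #|C|.
Proof.
move=> /andP[/forallP sizeC _].
rewrite (eq_bigr _ (fun D _ => codegreeE C D)).
rewrite (sum_incidence q (fun A _ => A \in C : nat)).
rewrite mulnC -sum_nat_const [RHS]big_mkcond [LHS]big_mkcond.
apply: eq_bigr => A _; have := sizeC A; case: (A \in C) => /=.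
  by move=> sA; rewrite sA sum_nat_const (eqP sA) muln1.
by rewrite big1 //; case: ifP.
Qed.

(** Each v outside a nonmember A yields a member of the form A - u + v with u in
    A, since A + v contains a member other than A. *)
Lemma sum_codegree_sub (n q : nat) (C : {set {set 'I_n}}) (A : {set 'I_n}) :
  turan_system q.+2 q.+1 C -> #|A| = q.+1 -> A \notin C ->
  n - q.+1 <= \sum_(u in A) codegree C (A :\ u).
Proof.
move=> /andP[/forallP sizeC /forallP turC] cardA nCA.
apply: (@leq_trans (\sum_(v | v \notin A) 1)).
  rewrite sum1_card; have := cardsC A; rewrite card_ord cardA => cardCA.
  rewrite -[X in X - _]cardCA addKn; apply: eq_leq.
  by apply: eq_card => i; rewrite !inE.
apply: (@leq_trans (\sum_(v | v \notin A) \sum_(u in A) (v |: (A :\ u) \in C))).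
  apply: leq_sum => v nAv.
  have := turC (v |: A); rewrite cardsU1 nAv cardA eqxx.
  move=> /existsP[B /andP[CB sB]].
  have /eqP cardB := implyP (sizeC B) CB.
  (* B differs from A and has the same size, so it misses some u in A, and then
     it must be A - u + v. *)
  have [u uA nBu] : exists2 u, u \in A & u \notin B.
    apply/fintype.subsetPn; move: nCA; apply: contra => sAB.
    by rewrite (_ : A = B) //; apply/eqP; rewrite eqEcard sAB cardA cardB leqnn.
  rewrite (bigD1 u) //= (_ : v |: (A :\ u) = B) ?CB //.
  apply/esym/eqP; rewrite eqEcard; apply/andP; split.
    apply/fintype.subsetP => w Bw; have := fintype.subsetP sB _ Bw.
    rewrite !inE; case: (w == v) => //= ->; rewrite andbT.
    by apply: contraNneq nBu => <-.
  rewrite cardB cardsU1 !inE (negbTE nAv) andbF.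
  by have := cardsD1 u A; rewrite uA cardA => ->.
rewrite exchange_big; apply: leq_sum => u uA; rewrite codegreeE /=.
rewrite big_mkcond [X in _ <= X]big_mkcond; apply: leq_sum => v _.
by rewrite !inE; case: (v \in A) => //; rewrite andbF.
Qed.

(** The right-hand side is the number of pairs formed by a nonmember and a member
    of size q + 1 that meet in q elements, sorted by their intersection D; on the
    left is the lower bound obtained by summing [sum_codegree_sub] over the
    nonmembers. *)
Lemma codegree_energy (n q : nat) (C : {set {set 'I_n}}) :
  turan_system q.+2 q.+1 C ->
  ('C(n, q.+1) - #|C|) * (n - q.+1) <=
  \sum_(D : {set 'I_n} | #|D| == q) (n - q - codegree C D) * codegree C D.
Proof.
move=> turC; have /andP[/forallP sizeC _] := turC.
have -> : \sum_(D : {set 'I_n} | #|D| == q) (n - q - codegree C D) * codegree C D =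
    \sum_(D : {set 'I_n} | #|D| == q)
      \sum_(u | u \notin D) (u |: D \notin C) * codegree C ((u |: D) :\ u).
  apply: eq_bigr => D /eqP cardD; have := codegreeC C D.
  rewrite card_ord cardD => <-; rewrite addKn big_distrl /=.
  by apply: eq_bigr => u nDu; rewrite finset.setU1K.
rewrite (sum_incidence q (fun A u => (A \notin C) * codegree C (A :\ u))).
have -> : 'C(n, q.+1) - #|C| = #|[set A : {set 'I_n} | #|A| == q.+1] :\: C|.
  rewrite cardsD card_draws card_ord; congr (_ - _); apply: eq_card => A.
  by have := sizeC A; rewrite !inE; case: (_ \in C) => /= [->|_]; rewrite ?andbF.
rewrite -sum_nat_const big_mkcond [X in _ <= X]big_mkcond; apply: leq_sum => A _.
rewrite !inE; case: (boolP (A \in C)) => //= nCA; case: eqP => // cardA.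
rewrite -big_distrr /= mul1n; exact: sum_codegree_sub.
Qed.

Local Open Scope classical_set_scope.
Local Open Scope ring_scope.

(** With r = q + 1 and n = N + r, the factor 1 - harmonic N is
    N / (N + 1) = (n - r) / (n - r + 1). *)
Lemma min_turan_bin_ge (R : realFieldType) (N q : nat) :
  (1 - harmonic N) / q.+1%:R <=
    (min_turan (N + q.+1) q.+2 q.+1)%:R / 'C(N + q.+1, q.+1)%:R :> R.
Proof.
set n := (N + q.+1)%N; have [C turC <-] := min_turanP n (leqnSn q.+1).
have nq : (n - q)%N = N.+1 by rewrite /n addnS subSn ?leq_addl // addnK.
have nq1 : (n - q.+1)%N = N by rewrite /n addnK.
have le_cB : (#|C| <= 'C(n, q.+1))%N.
  rewrite -[X in 'C(X, _)]card_ord -card_draws.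
  apply/subset_leq_card/fintype.subsetP => A CA; rewrite inE.
  by case/andP: turC => /forallP/(_ A); rewrite CA.
have energy : ('C(n, q.+1)%:R - #|C|%:R) * N%:R <=
    \sum_(D : {set 'I_n} | #|D| == q)
      (N.+1%:R - (codegree C D)%:R) * (codegree C D)%:R :> R.
  have := codegree_energy turC; rewrite nq nq1 -(ler_nat R) natrM natrB // natr_sum.
  move=> /le_trans; apply; apply: ler_sum => D /eqP cardD.
  rewrite natrM natrB //.
  by have := codegreeC C D; rewrite card_ord cardD nq => <-; rewrite leq_addr.
have sum_b : \sum_(D : {set 'I_n} | #|D| == q) (codegree C D)%:R =
    q.+1%:R * #|C|%:R :> R by rewrite -natr_sum (sum_codegree turC) natrM.
have sum_1 : \sum_(D : {set 'I_n} | #|D| == q) 1 = 'C(n, q)%:R :> R.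
  rewrite -[in RHS](card_ord n) -card_draws -sum1_card natr_sum.
  by apply: eq_bigl => D; rewrite inE.
have left_bin : q.+1%:R * 'C(n, q.+1)%:R = N.+1%:R * 'C(n, q)%:R :> R.
  by rewrite -!natrM mul_bin_left nq.
have bin_q_gt0 : 0 < 'C(n, q)%:R :> R by rewrite ltr0n bin_gt0; lia.
have bin_q1_gt0 : 0 < 'C(n, q.+1)%:R :> R by rewrite ltr0n bin_gt0; lia.
have q1_gt0 : 0 < q.+1%:R :> R by rewrite ltr0n.
have N1_gt0 : 0 < N.+1%:R :> R by rewrite ltr0n.
have N1E : N.+1%:R = N%:R + 1 :> R by rewrite -natr1.
have le_cBR : #|C|%:R <= 'C(n, q.+1)%:R :> R by rewrite ler_nat.
(* The codegrees average to x, so the sum of (b - x)^2 is the slack in the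
   Cauchy-Schwarz inequality. *)
pose x : R := q.+1%:R * #|C|%:R / 'C(n, q)%:R.
have xE : x * 'C(n, q)%:R = q.+1%:R * #|C|%:R by rewrite /x divfK ?gt_eqF.
have cauchy : \sum_(D : {set 'I_n} | #|D| == q)
      (N.+1%:R - (codegree C D)%:R) * (codegree C D)%:R <=
    (N.+1%:R - x) * (q.+1%:R * #|C|%:R) :> R.
  have -> : (N.+1%:R - x) * (q.+1%:R * #|C|%:R) =
      (N.+1%:R - x - x) * (q.+1%:R * #|C|%:R) + x ^+ 2 * 'C(n, q)%:R.
    by rewrite expr2 -mulrA xE; ring.
  rewrite -sum_b -sum_1 !mulr_sumr -big_split /=; apply: ler_sum => D _.
  by have := sqr_ge0 ((codegree C D)%:R - x); lra.
(* The two sides share the factor binomial(n, r) - |C|, which vanishes only when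
   C contains every r-set. *)
have key : ('C(n, q.+1)%:R - #|C|%:R) * (N%:R * 'C(n, q)%:R) <=
    ('C(n, q.+1)%:R - #|C|%:R) * (q.+1%:R * q.+1%:R * #|C|%:R) :> R.
  have := le_trans energy cauchy; rewrite -(ler_pM2r bin_q_gt0) => h.
  rewrite mulrA; apply: (le_trans h).
  have -> : (N.+1%:R - x) * (q.+1%:R * #|C|%:R) * 'C(n, q)%:R =
     (N.+1%:R * 'C(n, q)%:R - x * 'C(n, q)%:R) * (q.+1%:R * #|C|%:R) by ring.
  by rewrite xE -left_bin le_eqVlt; apply/orP; left; apply/eqP; ring.
have -> : 1 - harmonic N = N%:R / N.+1%:R :> R.
  apply: (canRL (mulfK (lt0r_neq0 N1_gt0))).
  by rewrite mulrBl mul1r mulVf ?lt0r_neq0 // N1E addrK.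
rewrite -mulrA -invfM ler_pdivrMr ?mulr_gt0 //.
rewrite mulrAC ler_pdivlMr //.
have [eq_cB|lt_cB] := eqVneq #|C| 'C(n, q.+1).
  rewrite eq_cB mulrC ler_pM2l // N1E.
  have : 1 <= q.+1%:R :> R by rewrite ler1n.
  have : 0 <= N%:R :> R by rewrite ler0n.
  by nra.
have lt_cBR : 0 < 'C(n, q.+1)%:R - #|C|%:R :> R.
  by rewrite subr_gt0 ltr_nat ltn_neqAle lt_cB.
move: key; rewrite ler_pM2l // -(ler_pM2l N1_gt0) => key.
rewrite -(ler_pM2l q1_gt0).
have -> : q.+1%:R * (N%:R * 'C(n, q.+1)%:R) = N.+1%:R * (N%:R * 'C(n, q)%:R) :> R.
  by rewrite mulrCA left_bin mulrCA.
by apply: (le_trans key); rewrite le_eqVlt; apply/orP; left; apply/eqP; ring.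
Qed.

(** * Convergence and comparison of the densities *)

(** Where c vanishes the ratio is 0 by the convention on division, so monotonicity
    also holds for the indices at which c is still 0. *)
Lemma ratio_nondecreasing (R : realFieldType) (r : nat) (a c : nat -> nat) :
  (forall n, n.+1 * a n <= (n.+1 - r) * a n.+1)%N ->
  (forall n, n.+1 * c n = (n.+1 - r) * c n.+1)%N ->
  nondecreasing_seq (fun n => (a n)%:R / (c n)%:R : R).
Proof.
move=> ha hc; apply/nondecreasing_seqP => n.
have [->|cn_gt0] := posnP (c n).
  by rewrite invr0 mulr0 divr_ge0.
have : (0 < (n.+1 - r) * c n.+1)%N by rewrite -hc muln_gt0.
rewrite muln_gt0 => /andP[d_gt0 cn1_gt0].
rewrite ler_pdivrMr ?ltr0n // mulrAC ler_pdivlMr ?ltr0n // -!natrM ler_nat.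
by rewrite -(leq_pmul2l d_gt0) mulnCA -hc mulnCA !mulnA leq_mul.
Qed.

Lemma ratio_le1 (R : realFieldType) (a c : nat) : (a <= c)%N ->
  (a%:R / c%:R : R) <= 1.
Proof.
move=> le_ac; have [->|c_gt0] := posnP c; first by rewrite invr0 mulr0.
by rewrite ler_pdivrMr ?ltr0n // mul1r ler_nat.
Qed.

Lemma turan_ratio_nondecreasing (R : realFieldType) (k r : nat) : (r <= k)%N ->
  nondecreasing_seq (fun n => (min_turan n k r)%:R / 'C(n, r)%:R : R).
Proof.
move=> le_rk; apply: (@ratio_nondecreasing R r (fun n => min_turan n k r)) => n.
  exact: mul_min_turan_le.
exact: mul_bin_down.
Qed.

Lemma is_cvg_turan_ratio (R : realType) (k r : nat) : (r <= k)%N ->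
  cvgn (fun n => (min_turan n k r)%:R / 'C(n, r)%:R : R).
Proof.
move=> le_rk; apply: nondecreasing_is_cvgn; first exact: turan_ratio_nondecreasing.
by exists 1 => _ [n _ <-]; exact/ratio_le1/min_turan_le_bin.
Qed.

Lemma turan_density_le1 (R : realType) (k r : nat) : (r <= k)%N ->
  turan_density R k r <= 1.
Proof.
move=> le_rk; apply: limr_le; first exact: is_cvg_turan_ratio.
by apply: nearW => n; exact/ratio_le1/min_turan_le_bin.
Qed.

Lemma turan_density_ge (R : realType) (r : nat) : (0 < r)%N ->
  1 / r%:R <= turan_density R r.+1 r.
Proof.
case: r => // q _.
have lim_l : (1 - harmonic N) / q.+1%:R @[N --> \oo] --> ((1 - 0) / q.+1%:R : R).
  by apply: cvgMl; apply: cvgB; [exact: cvg_cst|exact: cvg_harmonic].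
have lim_t : turan_density R q.+2 q.+1 @[_ --> \oo] --> turan_density R q.+2 q.+1.
  exact: cvg_cst.
rewrite subr0 in lim_l; apply: (ler_cvg_to lim_l lim_t).
apply: nearW => N; apply: le_trans (min_turan_bin_ge R N q) _.
apply: (nondecreasing_cvgn_le (turan_ratio_nondecreasing R (leqnSn q.+1))).
exact: is_cvg_turan_ratio.
Qed.

Lemma uniq_words_ratio_nondecreasing (R : realFieldType) (k r : nat) :
  (r <= k)%N ->
  nondecreasing_seq (fun n => (min_uniq_words n k r)%:R / (n ^_ r)%:R : R).
Proof.
move=> le_rk; apply: (@ratio_nondecreasing R r (fun n => min_uniq_words n k r)).
  by move=> n; exact: mul_min_uniq_words_le.
by move=> n; rewrite -!bin_ffact !mulnA -mul_bin_down.
Qed.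

Lemma is_cvg_uniq_words_ratio (R : realType) (k r : nat) : (r <= k)%N ->
  cvgn (fun n => (min_uniq_words n k r)%:R / (n ^_ r)%:R : R).
Proof.
move=> le_rk; apply: nondecreasing_is_cvgn.
  exact: uniq_words_ratio_nondecreasing.
by exists 1 => _ [n _ <-]; exact/ratio_le1/min_uniq_words_le_ffact.
Qed.

Lemma cvg_subn_ratio (R : realType) (r : nat) :
  (n - r)%:R / n%:R @[n --> \oo] --> (1 : R).
Proof.
have lim_l : 1 - r%:R * n%:R^-1 @[n --> \oo] --> (1 - r%:R * 0 : R).
  apply: cvgB; first exact: cvg_cst.
  apply: cvgMr; apply/gtr0_cvgV0; last exact: cvgr_idn.
  by near=> n; rewrite ltr0n; near: n; exact: nbhs_infty_gt.
rewrite mulr0 subr0 in lim_l; apply: cvg_trans lim_l; apply: near_eq_cvg.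
near=> n.
have n_gt0 : (0 < n)%N by near: n; exact: nbhs_infty_gt.
have le_rn : (r <= n)%N by near: n; exact: nbhs_infty_ge.
by rewrite natrB // mulrBl divff // pnatr_eq0 -lt0n.
Unshelve. all: by end_near. Qed.

Lemma cvg_ffact_ratio (R : realType) (r : nat) :
  (n ^_ r)%:R / n%:R ^+ r @[n --> \oo] --> (1 : R).
Proof.
elim: r => [|r IHr].
  by under eq_fun do rewrite ffactn0 expr0 divr1; exact: cvg_cst.
under eq_fun do rewrite ffactnSr exprSr natrM invfM mulrACA.
have lim_prod := cvgM (FF := _) IHr (cvg_subn_ratio r); rewrite mulr1 in lim_prod.
exact: lim_prod.
Qed.

(** Squeeze: with v the repetition-free ratio and q = n ^_ r / n ^ r, the ratio
    S(n,k,r) / n ^ r lies between v q and v q + 1 - q, and q tends to 1. *)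
Lemma cvg_insertion_ratio (R : realType) (k r : nat) : (r <= k)%N ->
  (min_insertion_code n k r)%:R / n%:R ^+ r @[n --> \oo] -->
  limn (fun n => (min_uniq_words n k r)%:R / (n ^_ r)%:R : R).
Proof.
move=> le_rk; pose v n : R := (min_uniq_words n k r)%:R / (n ^_ r)%:R.
rewrite -/v; set L := limn v.
pose q n : R := (n ^_ r)%:R / n%:R ^+ r.
have vq n : v n * q n = (min_uniq_words n k r)%:R / n%:R ^+ r.
  rewrite /v /q mulrA; have := min_uniq_words_le_ffact n le_rk.
  have [->|ff_gt0] := posnP (n ^_ r).
    by rewrite leqn0 => /eqP ->; rewrite !mul0r.
  by rewrite divfK // pnatr_eq0 -lt0n.
have cvg_vq : v n * q n @[n --> \oo] --> L.
  rewrite -[L]mulr1; apply: cvgM; last exact: cvg_ffact_ratio.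
  exact: is_cvg_uniq_words_ratio.
have cvg_up : v n * q n + (1 - q n) @[n --> \oo] --> L.
  rewrite -[L]addr0 -[0](subrr 1); apply: cvgD => //.
  by apply: cvgB; [exact: cvg_cst|exact: cvg_ffact_ratio].
apply: squeeze_cvgr cvg_vq cvg_up; near=> n.
have nr_gt0 : 0 < n%:R ^+ r :> R.
  by rewrite exprn_gt0 // ltr0n; near: n; exact: nbhs_infty_gt.
rewrite vq ler_pM2r ?invr_gt0 // ler_nat min_uniq_words_le_insertion //=.
rewrite -[X in X - q n](divff (lt0r_neq0 nr_gt0)) /q -mulrBl -mulrDl.
rewrite ler_pM2r ?invr_gt0 // addrA lerBrDr -natrX -!natrD ler_nat.
exact: min_insertion_code_le_uniq.
Unshelve. all: by end_near. Qed.

Lemma turan_density_le_insertion_density (R : realType) (k r : nat) :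
  (r <= k)%N -> turan_density R k r <= insertion_density R k r.
Proof.
move=> le_rk; rewrite /insertion_density (cvg_lim _ (cvg_insertion_ratio le_rk)) //.
apply: ler_lim.
- exact: is_cvg_turan_ratio.
- exact: is_cvg_uniq_words_ratio.
near=> n.
have le_rn : (r <= n)%N by near: n; exact: nbhs_infty_ge.
rewrite -bin_ffact natrM invfM mulrA mulrAC ler_pM2r ?invr_gt0 ?ltr0n ?bin_gt0 //.
rewrite ler_pdivlMr ?ltr0n ?fact_gt0 // -natrM ler_nat mulnC.
exact: fact_mul_min_turan_le.
Unshelve. all: by end_near. Qed.

Theorem corollary15 (R : realType) :
  exists eps : nat -> R,
    (eps n @[n --> \oo] --> (0 : R)) /\
    forall r : nat, (3 <= r)%N ->
      insertion_density R r.+1 r >=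
        1 / r%:R +
        (1 - eps r) *
          ((turan_density R r.+1 r - 1 / r%:R) / (2 * r%:R * (r`!)%:R)) ^+ 2.
Proof.
exists (fun=> 0); split=> [|r r_ge3]; first exact: cvg_cst.
have r_gt0 : (0 < r)%N by exact: leq_trans r_ge3.
apply: le_trans (turan_density_le_insertion_density R (leqnSn r)).
rewrite subr0 [1 * _ ^+ 2]mul1r -lerBrDl.
set d := turan_density R r.+1 r - 1 / r%:R; set m := 2 * r%:R * (r`!)%:R.
have d_ge0 : 0 <= d by rewrite subr_ge0 turan_density_ge.
have d_le1 : d <= 1.
  rewrite lerBlDr; apply: (le_trans (turan_density_le1 R (leqnSn r))).
  by rewrite lerDl divr_ge0.
have m_ge1 : 1 <= m by rewrite /m -!natrM ler1n !muln_gt0 r_gt0 fact_gt0.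
have m_gt0 : 0 < m by exact: lt_le_trans m_ge1.
have dm_ge0 : 0 <= d / m by rewrite divr_ge0 // ltW.
have dm_le_d : d / m <= d by rewrite ler_pdivrMr // ler_peMr.
rewrite expr2; apply: (le_trans _ dm_le_d).
by rewrite ler_piMr // (le_trans dm_le_d d_le1).
Qed.
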